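(* Let $X$ be a metric space with metric $\rho^X$, and let $Y = X \cup \{e\}$ (where $e \notin X$) be the pointed metric space with base point $e$ and metric given by $\rho^Y(p,q) = \min(\rho^X(p,q),2)$ for all $p,q \in X$ and $\rho^Y(p,e) = 1$ for all $p \in X$. Then $\text{Æ}(Y)$ is the strongly unique Banach space predual of $\mathrm{Lip}(X)$. That is, identifying $\mathrm{Lip}(X)$ with $\mathrm{Lip}_0(Y) \cong \text{Æ}(Y)^*$ in the natural way, for every Banach space $V$ every surjective isometric linear isomorphism $\phi: \mathrm{Lip}(X) \to V^*$ is continuous from the weak* topology on $\mathrm{Lip}(X)$ induced by $\text{Æ}(Y)$ to the weak* topology on $V^*$ induced by $V$.
   Context: All function spaces are real. For a metric space $(X,\rho)$ and $f: X \to \mathbb{R}$, the Lipschitz number is $L(f) = \sup_{p\neq q} \frac{|f(p)-f(q)|}{\rho(p,q)}$, and $f$ is Lipschitz if $L(f) < \infty$. $\mathrm{Lip}(X)$ is the Banach space of bounded Lipschitz functions $f: X \to \mathbb{R}$ with norm $\|f\|_L = \max(L(f), \|f\|_\infty)$. If $Y$ is a pointed metric space with base point $e$, $\mathrm{Lip}_0(Y)$ is the Banach space of all (possibly unbounded) Lipschitz functions $f: Y \to \mathbb{R}$ with $f(e) = 0$, with norm $L(\cdot)$. The Arens-Eells space (Lipschitz-free space) $\text{Æ}(Y)$ is the closed linear subspace of $\mathrm{Lip}_0(Y)^*$ generated by the point evaluations $\delta_p: f \mapsto f(p)$, $p \in Y$; the natural pairing gives an isometric isomorphism $\mathrm{Lip}_0(Y)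 \cong \text{Æ}(Y)^*$. For $X$ and $Y$ as in the claim, extending each function on $X$ by $0$ at $e$ gives an isometric isomorphism $\mathrm{Lip}(X) \cong \mathrm{Lip}_0(Y)$; this is the natural identification used in the claim. A dual Banach space $V^*$ is said to have a strongly unique predual if every isometric isomorphism between $V^*$ and another dual Banach space $W^*$ is weak* continuous (it is then a weak* homeomorphism, and its adjoint takes $W \subseteq W^{**}$ isometrically onto $V \subseteq V^{**}$). *)

(* Defs.v *)
From HB Require Import structures.
From mathcomp Require Import all_boot all_order all_algebra lra.
From mathcomp Require Import boolp classical_sets functions reals.
From mathcomp Require Import interval_inference topology normedtype.

Set Implicit Arguments.
Unset Strict Implicit.
Unset Printing Implicit Defensive.

Import Order.TTheory GRing.Theory Num.Theory.
Import numFieldNormedType.Exports.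

Local Open Scope classical_set_scope.
Local Open Scope ring_scope.

Section sup_family.
Context {R : realType} {I : Type}.
Implicit Types (D : set I) (g h : I -> R).

Lemma sup_family_ge0 D g : (forall i, D i -> 0 <= g i) ->
  0 <= sup [set g i | i in D].
Proof.
move=> g0; set S := [set _ | _ in _].
have [hS|nS] := pselect (has_sup S); last by rewrite sup_out.
have [[x Sx] uS] := hS; apply: le_trans (ub_le_sup uS Sx).
by case: Sx => i Di <-; exact: g0.
Qed.

Lemma sup_family_le D g M : 0 <= M -> (forall i, D i -> g i <= M) ->
  sup [set g i | i in D] <= M.
Proof.
move=> M0 gM; set S := [set _ | _ in _].
have [->|/set0P S0] := eqVneq S set0; first by rewrite sup0.
by apply: ge_sup => // _ [i Di <-]; exact: gM.
Qed.

Lemma le_sup_family D g i : has_ubound [set g i | i in D] -> D i ->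
  g i <= sup [set g i | i in D].
Proof. by move=> ug Di; apply: ub_le_sup => //; exists i. Qed.

Lemma sup_familyZ D g h (c : R) : 0 <= c ->
  has_ubound [set g i | i in D] -> (forall i, D i -> 0 <= g i) ->
  (forall i, D i -> h i = c * g i) ->
  sup [set h i | i in D] = c * sup [set g i | i in D].
Proof.
move=> c0 ug g0 hE.
have le_h : sup [set h i | i in D] <= c * sup [set g i | i in D].
  apply: sup_family_le; first by rewrite mulr_ge0// sup_family_ge0.
  by move=> i Di; rewrite hE// ler_wpM2l// le_sup_family.
apply/eqP; rewrite eq_le le_h/=.
have h0 i : D i -> 0 <= h i by move=> Di; rewrite hE// mulr_ge0// g0.
move: c0; rewrite [0 <= c]le_eqVlt => /orP[/eqP<-|c0].
  by rewrite mul0r sup_family_ge0.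
rewrite -ler_pdivlMl//; apply: sup_family_le.
  by rewrite mulr_ge0// ?invr_ge0 ?(ltW c0)// sup_family_ge0.
move=> i Di; rewrite ler_pdivlMl// -hE//; apply: le_sup_family => //.
exists (c * sup [set g i | i in D]) => _ [j Dj <-].
by rewrite hE// ler_pM2l// le_sup_family.
Qed.

Lemma sup_familyD D (f g h : I -> R) :
  has_ubound [set f i | i in D] -> has_ubound [set g i | i in D] ->
  (forall i, D i -> 0 <= f i) -> (forall i, D i -> 0 <= g i) ->
  (forall i, D i -> h i <= f i + g i) ->
  sup [set h i | i in D] <= sup [set f i | i in D] + sup [set g i | i in D].
Proof.
move=> uf ug f0 g0 hE; apply: sup_family_le.
  by rewrite addr_ge0// sup_family_ge0.
by move=> i Di; rewrite (le_trans (hE i Di))// lerD// le_sup_family.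
Qed.

End sup_family.

Section lipschitz_number.
Context {R : realType} {X : metricType R}.
Implicit Types f g : X -> R.

Definition slopes f : set R :=
  [set `|f z.1 - f z.2| / mdist z.1 z.2 | z in [set z : X * X | z.1 != z.2]].

(* [sup] is [0] on the empty set (case of at most one point) and on sets that
   are not bounded above, so that [lipnum f] is only meaningful under
   [is_lipschitz f]. *)
Definition lipnum f : R := sup (slopes f).
Definition is_lipschitz f := has_ubound (slopes f).

Definition is_bounded f := has_ubound (range (fun p => `|f p|)).
Definition supnorm f : R := sup (range (fun p => `|f p|)).

Lemma slope_ge0 f (z : X * X) : 0 <= `|f z.1 - f z.2| / mdist z.1 z.2.
Proof. by rewrite divr_ge0// mdist_ge0. Qed.

Lemma is_lipschitzP f :
  is_lipschitz f <-> exists2 M, 0 <= M &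
    forall p q, `|f p - f q| <= M * mdist p q.
Proof.
split=> [[M fM]|[M M0 fM]].
  exists (Num.max M 0); first by rewrite le_max lexx orbT.
  move=> p q; have [->|pq] := eqVneq p q; first by rewrite subrr mdistxx mulr0 normr0.
  rewrite -ler_pdivrMr ?mdist_gt0// le_max; apply/orP; left.
  by apply: fM; exists (p, q).
exists M => _ [[p q]/= pq <-].
by rewrite ler_pdivrMr ?mdist_gt0.
Qed.

Lemma lipnum_ge0 f : 0 <= lipnum f.
Proof. by apply: sup_family_ge0 => z _; exact: slope_ge0. Qed.

Lemma le_lipnum f p q : is_lipschitz f -> `|f p - f q| <= lipnum f * mdist p q.
Proof.
move=> lf; have [->|pq] := eqVneq p q; first by rewrite subrr mdistxx mulr0 normr0.
rewrite -ler_pdivrMr ?mdist_gt0//.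
exact: (@le_sup_family _ _ _ (fun z => `|f z.1 - f z.2| / mdist z.1 z.2) (p, q)).
Qed.

Lemma lipnum_le f M : 0 <= M -> (forall p q, `|f p - f q| <= M * mdist p q) -> lipnum f <= M.
Proof.
move=> M0 fM; apply: sup_family_le => // -[p q]/= pq.
by rewrite ler_pdivrMr ?mdist_gt0.
Qed.

Lemma lipnumZ a f : is_lipschitz f -> lipnum (a *: f) = `|a| * lipnum f.
Proof.
move=> lf; apply: sup_familyZ => // z _; first exact: slope_ge0.
by rewrite -scalerBr normrM mulrA.
Qed.

Lemma lipnumD f g : is_lipschitz f -> is_lipschitz g -> lipnum (f + g) <= lipnum f + lipnum g.
Proof.
move=> lf lg; apply: sup_familyD => // z zz; rewrite ?slope_ge0//.
rewrite -mulrDl ler_wpM2r ?invr_ge0 ?mdist_ge0//.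
by rewrite opprD addrACA ler_normD.
Qed.

Lemma is_lipschitz_comb a f g : is_lipschitz f -> is_lipschitz g ->
  is_lipschitz (a *: f + g).
Proof.
move=> /is_lipschitzP[M M0 fM] /is_lipschitzP[N N0 gN].
apply/is_lipschitzP; exists (`|a| * M + N).
  by rewrite addr_ge0// mulr_ge0.
move=> p q; rewrite opprD addrACA mulrDl (le_trans (ler_normD _ _))//.
by rewrite lerD// -scalerBr normrM -mulrA ler_wpM2l.
Qed.

Lemma is_lipschitz0 : is_lipschitz (0 : X -> R).
Proof. by exists 0 => _ [z _ <-]; rewrite subrr normr0 mul0r. Qed.

Lemma le_supnorm f p : is_bounded f -> `|f p| <= supnorm f.
Proof. by move=> bf; exact: (@le_sup_family _ _ _ (fun p => `|f p|)). Qed.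

Lemma supnormZ a f : is_bounded f -> supnorm (a *: f) = `|a| * supnorm f.
Proof. by move=> bf; apply: sup_familyZ => // p _; rewrite normrM. Qed.

Lemma supnormD f g : is_bounded f -> is_bounded g ->
  supnorm (f + g) <= supnorm f + supnorm g.
Proof. by move=> bf bg; apply: sup_familyD => // p _; exact: ler_normD. Qed.

Lemma is_bounded_comb a f g : is_bounded f -> is_bounded g ->
  is_bounded (a *: f + g).
Proof.
move=> bf bg; exists (`|a| * supnorm f + supnorm g) => _ [p _ <-].
rewrite (le_trans (ler_normD _ _))// lerD ?le_supnorm// normrM.
by rewrite ler_wpM2l ?le_supnorm.
Qed.

Lemma is_bounded0 : is_bounded (0 : X -> R).
Proof. by exists 0 => _ [z _ <-]; rewrite normr0. Qed.

End lipschitz_number.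

Section Lip.
Context {R : realType} (X : metricType R).

Definition lip_pred : {pred X -> R} :=
  [pred f | `[< is_lipschitz f /\ is_bounded f >]].

Record Lip := MkLip { lip_fun :> X -> R; lip_funP : lip_fun \in lip_pred }.

HB.instance Definition _ := [isSub for lip_fun].
HB.instance Definition _ := [Choice of Lip by <:].

Fact lip_submod_closed : submod_closed lip_pred.
Proof.
split=> [|a f g]; rewrite !inE.
  by split; [exact: is_lipschitz0|exact: is_bounded0].
move=> [lf bf] [lg bg]; split.
  exact: is_lipschitz_comb.
exact: is_bounded_comb.
Qed.

HB.instance Definition _ :=
  GRing.isSubmodClosed.Build R (X -> R) lip_pred lip_submod_closed.
HB.instance Definition _ := [SubChoice_isSubLmodule of Lip by <:].

Lemma lip_lipschitz (f : Lip) : is_lipschitz f.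
Proof. by have /asboolP[] := lip_funP f. Qed.

Lemma lip_bounded (f : Lip) : is_bounded f.
Proof. by have /asboolP[] := lip_funP f. Qed.

Definition lip_norm (f : Lip) : R := Num.max (lipnum f) (supnorm f).

Fact lip_normD (f g : Lip) : lip_norm (f + g) <= lip_norm f + lip_norm g.
Proof.
have [lf lg] := (lip_lipschitz f, lip_lipschitz g).
have [bf bg] := (lip_bounded f, lip_bounded g).
rewrite ge_max; apply/andP; split.
  by rewrite (le_trans (lipnumD lf lg))// lerD// le_max lexx.
by rewrite (le_trans (supnormD bf bg))// lerD// le_max lexx orbT.
Qed.

Fact lip_normZ (a : R) (f : Lip) : lip_norm (a *: f) = `|a| * lip_norm f.
Proof.
rewrite /lip_norm (lipnumZ a (lip_lipschitz f)) (supnormZ a (lip_bounded f)).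
by rewrite maxr_pMr.
Qed.

Fact lip_norm0_eq0 (f : Lip) : lip_norm f = 0 -> f = 0.
Proof.
move=> f0; apply/val_inj/funext => p; apply/normr0_eq0/le_anti.
rewrite normr_ge0 andbT -[leRHS]f0 le_max (le_supnorm p (lip_bounded f)).
by rewrite orbT.
Qed.

HB.instance Definition _ :=
  Lmodule_isNormed.Build R Lip lip_normD lip_normZ lip_norm0_eq0.

End Lip.

Section Lip0.
Context {R : realType} (Y : metricType R) (e : Y).

Definition lip0_pred : {pred Y -> R} :=
  [pred f | `[< is_lipschitz f /\ f e = 0 >]].

Record Lip0 := MkLip0 { lip0_fun :> Y -> R; lip0_funP : lip0_fun \in lip0_pred }.

HB.instance Definition _ := [isSub for lip0_fun].
HB.instance Definition _ := [Choice of Lip0 by <:].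

Fact lip0_submod_closed : submod_closed lip0_pred.
Proof.
split=> [|a f g]; rewrite !inE.
  by split; first exact: is_lipschitz0.
move=> [lf f0] [lg g0]; split.
  exact: is_lipschitz_comb.
by rewrite -[LHS]/(a * f e + g e) f0 g0 mulr0 addr0.
Qed.

HB.instance Definition _ :=
  GRing.isSubmodClosed.Build R (Y -> R) lip0_pred lip0_submod_closed.
HB.instance Definition _ := [SubChoice_isSubLmodule of Lip0 by <:].

Lemma lip0_lipschitz (f : Lip0) : is_lipschitz f.
Proof. by have /asboolP[] := lip0_funP f. Qed.

Lemma lip0_base (f : Lip0) : f e = 0.
Proof. by have /asboolP[] := lip0_funP f. Qed.

Definition lip0_norm (f : Lip0) : R := lipnum f.

Fact lip0_normD (f g : Lip0) : lip0_norm (f + g) <= lip0_norm f + lip0_norm g.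
Proof. by apply: lipnumD; exact: lip0_lipschitz. Qed.

Fact lip0_normZ (a : R) (f : Lip0) : lip0_norm (a *: f) = `|a| * lip0_norm f.
Proof. by apply: lipnumZ; exact: lip0_lipschitz. Qed.

Fact lip0_norm0_eq0 (f : Lip0) : lip0_norm f = 0 -> f = 0.
Proof.
move=> f0; apply/val_inj/funext => p; apply/normr0_eq0/le_anti.
rewrite normr_ge0 andbT -[X in `|X|]subr0 -[X in _ - X](lip0_base f).
by rewrite (le_trans (le_lipnum p e (lip0_lipschitz f)))// -/(lip0_norm f) f0 mul0r.
Qed.

HB.instance Definition _ :=
  Lmodule_isNormed.Build R Lip0 lip0_normD lip0_normZ lip0_norm0_eq0.

End Lip0.

Section dual.
Context {R : realType} (V : normedModType R).

Definition dual_pred : {pred V -> R} :=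
  [pred phi : V -> R | `[< scalar phi /\ continuous phi >]].

Record dual :=
  MkDual { dual_fun :> V -> R; dual_funP : dual_fun \in dual_pred }.

HB.instance Definition _ := [isSub for dual_fun].
HB.instance Definition _ := [Choice of dual by <:].

Fact dual_submod_closed : submod_closed dual_pred.
Proof.
split=> [|a f g]; rewrite !inE.
  split; first by move=> a u v; rewrite /= mulr0 addr0.
  exact: cst_continuous.
move=> [lf cf] [lg cg]; split.
  move=> b u v; rewrite -![(_ + g) _]/(a * f _ + g _) lf lg.
  by rewrite !mulrDr !mulrA [a * b]mulrC addrACA.
by move=> v; apply: cvgD; [apply: cvgMr; exact: cf|exact: cg].
Qed.

HB.instance Definition _ :=
  GRing.isSubmodClosed.Build R (V -> R) dual_pred dual_submod_closed.
HB.instance Definition _ := [SubChoice_isSubLmodule of dual by <:].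

Definition dual_norm (phi : dual) : R :=
  sup [set `|phi v| | v in [set v : V | `|v| <= 1]].

Lemma dual_linear (phi : dual) : scalar phi.
Proof. by have /asboolP[] := dual_funP phi. Qed.

Lemma dual_continuous (phi : dual) : continuous phi.
Proof. by have /asboolP[] := dual_funP phi. Qed.

Let dual_lin (phi : dual) : {linear V -> R} :=
  HB.pack (dual_fun phi) (GRing.isLinear.Build R V R *%R phi (dual_linear phi)).

Lemma dualB (phi : dual) u v : phi (u - v) = phi u - phi v.
Proof. exact: (linearB (dual_lin phi)). Qed.

Lemma dualZ (phi : dual) a v : phi (a *: v) = a * phi v.
Proof. exact: (linearZ_LR (dual_lin phi)). Qed.

Lemma dual_bounded (phi : dual) :
  has_ubound [set `|phi v| | v in [set v : V | `|v| <= 1]].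
Proof.
have /(linear_bounded_continuous (dual_lin phi))/bounded_funP/(_ 1)[M phiM] :=
  @dual_continuous phi.
by exists M => _ [v v1 <-]; exact: phiM.
Qed.

Lemma le_dual_norm (phi : dual) v : `|phi v| <= dual_norm phi * `|v|.
Proof.
have [->|v0] := eqVneq v 0.
  by rewrite -(subrr (0 : V)) dualB subrr subrr !normr0 mulr0.
have v_gt0 : 0 < `|v| by rewrite normr_gt0.
rewrite -ler_pdivrMr// mulrC -[X in X * _]gtr0_norm ?invr_gt0// -normrM -dualZ.
apply: (@le_sup_family _ _ _ (fun v => `|phi v|)); first exact: dual_bounded.
by rewrite /= normrZ gtr0_norm ?invr_gt0// mulVf// gt_eqF.
Qed.

Lemma dual_norm_ge0 (phi : dual) : 0 <= dual_norm phi.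
Proof. exact: sup_family_ge0. Qed.

Lemma dual_norm_le (phi : dual) M : 0 <= M ->
  (forall v, `|phi v| <= M * `|v|) -> dual_norm phi <= M.
Proof.
move=> M0 phiM; apply: sup_family_le => // v /= v1.
by rewrite (le_trans (phiM v))// ler_piMr.
Qed.

Lemma bounded_dualP (f : V -> R) (M : R) : scalar f ->
  (forall v, `|f v| <= M * `|v|) -> f \in dual_pred.
Proof.
move=> lf fM; rewrite inE; split=> //.
pose fl : {linear V -> R} :=
  HB.pack f (GRing.isLinear.Build R V R *%R f lf).
apply/(@linear_bounded_continuous _ _ _ fl)/bounded_funP => r.
exists (`|M| * r) => v vr; rewrite (le_trans (fM v))//.
rewrite (@le_trans _ _ (`|M| * `|v|)) ?ler_wpM2l//.
by rewrite ler_wpM2r// ler_norm.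
Qed.

Fact dual_normD (phi psi : dual) :
  dual_norm (phi + psi) <= dual_norm phi + dual_norm psi.
Proof.
apply: sup_familyD => //; try exact: dual_bounded.
by move=> v _; exact: ler_normD.
Qed.

Fact dual_normZ (a : R) (phi : dual) :
  dual_norm (a *: phi) = `|a| * dual_norm phi.
Proof.
apply: sup_familyZ => //; first exact: dual_bounded.
by move=> v _; exact: normrM.
Qed.

Fact dual_norm0_eq0 (phi : dual) : dual_norm phi = 0 -> phi = 0.
Proof.
move=> phi0; apply/val_inj/funext => v; apply/normr0_eq0/le_anti.
by rewrite normr_ge0 andbT (le_trans (le_dual_norm phi v))// phi0 mul0r.
Qed.

HB.instance Definition _ :=
  Lmodule_isNormed.Build R dual dual_normD dual_normZ dual_norm0_eq0.

Fact dual_complete (F : set_system dual) : ProperFilter F -> cauchy F -> cvg F.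
Proof.
move=> FF /cauchy_ballP Fc.
have Fv v : cvg ((fun phi : dual => phi v) @ F).
  apply/cauchy_cvgP/cauchy_ballP => e e0.
  have v1 : 0 < `|v| + 1 by rewrite ltr_wpDl.
  have := Fc (e / (`|v| + 1)) (divr_gt0 e0 v1).
  rewrite !near_simpl => -[[A B]/= [FA FB] AB].
  exists ([set phi v | phi in A], [set phi v | phi in B]) => /=.
    by split; [apply: filterS FA|apply: filterS FB] => phi ?; exists phi.
  move=> [_ _]/= [[phi Aphi <-] [psi Bpsi <-]].
  have := AB (phi, psi) (conj Aphi Bpsi); rewrite /= -!ball_normE/= => lt_e.
  rewrite -[phi v - psi v]/((phi - psi) v).
  apply: le_lt_trans (le_dual_norm _ _) _.
  move: lt_e; rewrite ltr_pdivlMr//; apply: le_lt_trans.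
  by rewrite ler_wpM2l ?dual_norm_ge0// lerDl.
pose f v := lim ((fun phi : dual => phi v) @ F).
have lf : scalar f.
  move=> a u v; apply/cvg_lim => //.
  have -> : (fun phi : dual => phi (a *: u + v)) =
            (fun phi : dual => a * phi u + phi v).
    by apply/funext => phi; exact: dual_linear.
  by apply: cvgD; [apply: cvgMr; exact: Fv|exact: Fv].
have near_f (r : R) : 0 < r ->
    F [set phi : dual | forall v, `|f v - phi v| <= r * `|v|].
  move=> r0; have := Fc r r0; rewrite !near_simpl => -[[A B]/= [FA FB] AB].
  apply: filterS FB => phi Bphi v /=.
  have cvA : (fun psi : dual => `|psi v - phi v|) @ F --> `|f v - phi v|.
    by apply: cvg_norm; apply: cvgB; [exact: Fv|exact: cvg_cst].
  apply: (@closed_cvg _ _ F _ _ (fun x => x <= r * `|v|) _ _ _ cvA).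
    exact: closed_le.
  apply: filterS FA => psi Apsi /=.
  have := AB (psi, phi) (conj Apsi Bphi); rewrite /= -ball_normE/= => /ltW le_r.
  rewrite -[psi v - phi v]/((psi - phi) v).
  by rewrite (le_trans (le_dual_norm _ _))// ler_wpM2r.
have [phi0 phi0f] := filter_ex (near_f 1 ltr01).
have fP : f \in dual_pred.
  apply: (@bounded_dualP _ (dual_norm phi0 + 1)) => // v.
  rewrite -(subrK (phi0 v) (f v)) (le_trans (ler_normD _ _))// mulrDl addrC.
  by rewrite lerD ?le_dual_norm// phi0f.
apply/cvg_ex; exists (MkDual fP); apply/cvgrPdist_le => e e0.
apply: filterS (near_f e e0) => phi fphi.
by apply: dual_norm_le => //; exact: ltW.
Qed.

HB.instance Definition _ := Uniform_isComplete.Build dual dual_complete.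

End dual.

(* The weak* topology of [dual V]: the initial topology for the inclusion of
   [dual V] into [V -> R] with the topology of pointwise convergence. *)
Definition weakstar {R : realType} (V : normedModType R) : topologicalType :=
  initial_topology (@dual_fun R V : dual V -> {ptws V -> R}).

Section ArensEells.
Context {R : realType} (Y : metricType R) (e : Y).

Fact delta_subproof (p : Y) :
  (fun f : Lip0 e => f p) \in @dual_pred R (Lip0 e).
Proof.
apply: (@bounded_dualP _ _ _ (mdist p e)) => // f.
have := le_lipnum p e (lip0_lipschitz f).
by rewrite (lip0_base f) subr0 mulrC.
Qed.

Definition delta (p : Y) : dual (Lip0 e) := MkDual (delta_subproof p).

Definition closed_subspace (V : normedModType R) (S : set V) :=
  [/\ closed S, S 0 & forall (a : R) u v, S u -> S v -> S (a *: u + v)].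

Definition AE_pred : {pred dual (Lip0 e)} :=
  [pred m | m \in smallest (@closed_subspace (dual (Lip0 e))) (range delta)].

Record AE := MkAE { AE_val :> dual (Lip0 e); AE_valP : AE_val \in AE_pred }.

HB.instance Definition _ := [isSub for AE_val].
HB.instance Definition _ := [Choice of AE by <:].

Fact AE_submod_closed : submod_closed AE_pred.
Proof.
split=> [|a u v]; rewrite !inE; first by move=> S [[]].
by move=> Su Sv S SS; have [[_ _ Slin] _] := SS; apply: Slin; [exact: Su|exact: Sv].
Qed.

HB.instance Definition _ :=
  GRing.isSubmodClosed.Build R (dual (Lip0 e)) AE_pred AE_submod_closed.
HB.instance Definition _ := [SubChoice_isSubLmodule of AE by <:].

Definition AE_norm (m : AE) : R := `|AE_val m|.

Fact AE_normD (m n : AE) : AE_norm (m + n) <= AE_norm m + AE_norm n.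
Proof. exact: ler_normD. Qed.

Fact AE_normZ (a : R) (m : AE) : AE_norm (a *: m) = `|a| * AE_norm m.
Proof. exact: normrZ. Qed.

Fact AE_norm0_eq0 (m : AE) : AE_norm m = 0 -> m = 0.
Proof. by move=> /normr0_eq0 m0; exact: val_inj. Qed.

HB.instance Definition _ :=
  Lmodule_isNormed.Build R AE AE_normD AE_normZ AE_norm0_eq0.

Fact AE_complete (F : set_system AE) : ProperFilter F -> cauchy F -> cvg F.
Proof.
move=> FF /cauchy_ballP Fc.
have /cvg_ex[l Fl] : cvg (AE_val @ F).
  apply/cauchy_cvgP/cauchy_ballP => r r0.
  have := Fc r r0; rewrite !near_simpl => -[[A B]/= [FA FB] AB].
  exists ([set AE_val m | m in A], [set AE_val m | m in B]) => /=.
    by split; [apply: filterS FA|apply: filterS FB] => m ?; exists m.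
  move=> [_ _]/= [[m Am <-] [n Bn <-]].
  by have := AB (m, n) (conj Am Bn); rewrite /= -!ball_normE.
have lP : l \in AE_pred.
  rewrite !inE => S [[Scl S0 Slin] dS].
  apply: (@closed_cvg _ _ F _ AE_val S Scl _ _ Fl).
  apply: nearW => m; have := AE_valP m; rewrite !inE; apply.
  by split.
apply/cvg_ex; exists (MkAE lP); apply/cvgrPdist_lt => r r0.
by move/cvgrPdist_lt : Fl => /(_ r r0).
Qed.

HB.instance Definition _ := Uniform_isComplete.Build AE AE_complete.

Fact AE_pairing_subproof (f : Lip0 e) :
  (fun m : AE => AE_val m f) \in @dual_pred R AE.
Proof.
apply: (@bounded_dualP _ _ _ `|f|) => // m.
by rewrite mulrC; exact: le_dual_norm.
Qed.

Definition AE_pairing (f : Lip0 e) : dual AE := MkDual (AE_pairing_subproof f).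

End ArensEells.

(* [X] together with the point [None], which is the base point. *)
Definition adjoin (X : Type) : Type := option X.

Section adjoin.
Context {R : realType} (X : metricType R).

HB.instance Definition _ := Choice.copy (adjoin X) (option X).

Definition adjoin_dist (p q : adjoin X) : R :=
  match p, q with
  | Some p, Some q => Num.min (mdist p q) 2
  | None, None => 0
  | _, _ => 1
  end.

Fact adjoin_distxx p : adjoin_dist p p = 0.
Proof. by case: p => //= p; rewrite mdistxx min_l. Qed.

Fact adjoin_dist_eq0 p q : adjoin_dist p q = 0 -> p = q.
Proof.
case: p q => [p|] [q|]//=; try by move/eqP; rewrite oner_eq0.
rewrite /Num.min; case: ifP => _; first by move/mdist_positivity ->.
by move/eqP; rewrite pnatr_eq0.
Qed.

Fact adjoin_dist_sym p q : adjoin_dist p q = adjoin_dist q p.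
Proof. by case: p q => [p|] [q|]//=; rewrite metric_sym. Qed.

Fact adjoin_dist_triangle q p r :
  adjoin_dist p r <= adjoin_dist p q + adjoin_dist q r.
Proof.
have min0 (x y : X) : 0 <= Num.min (mdist x y) 2 by rewrite le_min mdist_ge0/=.
case: p q r => [p|] [q|] [r|]//=; rewrite ?addr0 ?add0r ?lerDl ?lerDr ?addr_ge0//.
- have := metric_triangle p q r; have := mdist_ge0 p q; have := mdist_ge0 q r.
  by rewrite /Num.min; do 3 case: ltP => ?; lra.
- by rewrite ge_min -[1 + 1]/(2 : R) lexx orbT.
Qed.

HB.instance Definition _ := isMetric.Build R (adjoin X)
  adjoin_distxx adjoin_dist_eq0 adjoin_dist_sym adjoin_dist_triangle.

Definition base : adjoin X := None.

Definition ext0_fun (f : X -> R) (p : adjoin X) : R :=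
  if p is Some x then f x else 0.

Fact ext0_subproof (f : Lip X) : ext0_fun f \in lip0_pred base.
Proof.
rewrite inE; split=> //; apply/is_lipschitzP.
exists `|f|; first exact: normr_ge0.
have fs p : `|f p| <= `|f|.
  by rewrite [leRHS]/Num.norm/= le_max (le_supnorm _ (lip_bounded f)) orbT.
have fL p q : `|f p - f q| <= `|f| * mdist p q.
  rewrite (le_trans (le_lipnum p q (lip_lipschitz f)))// ler_wpM2r ?mdist_ge0//.
  by rewrite [leRHS]/Num.norm/= le_max lexx.
case=> [p|] [q|] /=; rewrite ?subr0 ?sub0r ?normrN ?normr0.
- rewrite minr_pMr// le_min fL/= (le_trans (ler_normB _ _))//.
  by rewrite mulr_natr mulr2n lerD.
- by rewrite mulr1.
- by rewrite mulr1.
- by rewrite mulr0.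
Qed.

Definition ext0 (f : Lip X) : Lip0 base := MkLip0 (ext0_subproof f).

End adjoin.

Definition isometric_isomorphism {R : realType} (E F : normedModType R)
    (phi : E -> F) :=
  [/\ linear phi, (forall x, `|phi x| = `|x|) & (forall y, exists x, phi x = y)].

(* [V] is the strongly unique predual of [E], where [E] is identified with
   [dual V] through the isometric isomorphism [J]; the weak* topology of [E]
   induced by [V] is that of [weakstar V] transported along [J]. *)
Definition strongly_unique_predual {R : realType} (E : normedModType R)
    (V : completeNormedModType R) (J : E -> dual V) :=
  isometric_isomorphism J /\
  forall (W : completeNormedModType R) (phi : E -> dual W),
    isometric_isomorphism phi ->
    continuous
      (phi : initial_topology (J : E -> weakstar V) -> weakstar W).

(* Main.v *)
Require Import Defs.
From mathcomp Require Import all_boot all_order all_algebra lra.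
From mathcomp Require Import boolp classical_sets functions reals.
From mathcomp Require Import interval_inference topology normedtype.

(** Identify [W] with a space of functionals on [Lip X] through an isometric
isomorphism [phi] of [Lip X] onto [dual W], the vector [w] acting by
[f |-> phi f w]. It is enough to show that each [w] acts as an element of the
Arens-Eells space; [phi] is then continuous for the weak* topologies because
all its coordinates are.

The heart of the matter is that evaluation at a point [p] belongs to [W]
([evaluation_in_predual]). The function [h = 1 - min (rho (p, -), 2) / 2] has
norm [1], takes the value [1] at [p], and has Lipschitz number at most [1 / 2].
For every [f] in the unit ball, [`|4 h + f| <= 4 + f p] ([norm_peak_add]). Let
[w] in the unit ball of [W] almost attain the norm of [phi h], say
[phi h w >= 1 - eta / 4]. Then

  [phi f w = phi (4 h + f) w - 4 phi h w <= f p + eta],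

and the same inequality for [- f] shows that [w] differs from the evaluation
at [p] by at most [eta] on the unit ball ([evaluation_approx]). Since [W] is
complete, evaluation at [p] is given by some [w_p] in [W].

If [psi] in [dual W] vanishes at all the [w_p], then [psi = phi f] where [f]
vanishes at all points, so that [psi = 0]. By the Hahn-Banach theorem, a closed
subspace of [W] that contains all the [w_p] is all of [W]
([annihilator_eq0_full]). Now [W] maps continuously into the dual of [Lip0],
where [w_p] goes to the evaluation at [p], hence the image of [W] lies in every
closed subspace that contains the evaluations, that is, in the Arens-Eells
space ([predual_in_AE]).

That the Arens-Eells space is a predual of [Lip X] is the usual duality
([isometric_isomorphism_AE_pairing]), composed with the extension by [0] at the
base point ([isometric_isomorphism_ext0]). *)

Set Implicit Arguments.
Unset Strict Implicit.
Unset Printing Implicit Defensive.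

Import Order.TTheory GRing.Theory Num.Theory.
Import numFieldNormedType.Exports.

Local Open Scope classical_set_scope.
Local Open Scope ring_scope.

(** * The Hahn-Banach theorem *)

Section hahn_banach.
Context {R : realType} {V : lmodType R}.
Implicit Types (p q f : V -> R) (C : set V).

(** Positive homogeneity is only required as an inequality; equality follows,
    see [sublinearZ]. *)
Definition sublinear p :=
  (forall x y, p (x + y) <= p x + p y) /\
  (forall (t : R) x, 0 <= t -> p (t *: x) <= t * p x).

Lemma sublinear0 p : sublinear p -> p 0 = 0.
Proof.
move=> [pD pZ]; apply/le_anti/andP; split.
  by have := pZ 0 0 (lexx 0); rewrite scale0r mul0r.
by have := pD 0 0; rewrite addr0 lerDl.
Qed.

Lemma sublinearZ p (t : R) x : sublinear p -> 0 <= t -> p (t *: x) = t * p x.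
Proof.
move=> sp; rewrite le_eqVlt => /predU1P[<-|t0].
  by rewrite scale0r mul0r sublinear0.
have [_ pZ] := sp; apply/le_anti/andP; split; first exact/pZ/ltW.
rewrite -ler_pdivlMl// -[in leLHS](scalerK (lt0r_neq0 t0) x).
by rewrite pZ// invr_ge0 ltW.
Qed.

Definition convex_cone C :=
  [/\ C 0, forall x y, C x -> C y -> C (x + y) &
    forall (t : R) x, 0 <= t -> C x -> C (t *: x)].

(** Superadditivity and positive homogeneity of [f] restricted to the cone [C];
    the values of [f] outside [C] are irrelevant. *)
Definition superlinear_on C f :=
  (forall x y, C x -> C y -> f x + f y <= f (x + y)) /\
  (forall (t : R) x, 0 <= t -> C x -> t * f x <= f (t *: x)).

(** For [p] sublinear and [f <= p] superlinear on a convex cone [C], this is the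
    largest sublinear functional [q <= p] such that [q (- z) <= - f z] for all
    [z] in [C]. *)
Definition cone_inf p C f x : R := inf [set p (x + z) - f z | z in C].

Section cone_inf.
Variables (p : V -> R) (C : set V) (f : V -> R).
Hypotheses (sp : sublinear p) (coneC : convex_cone C).
Hypotheses (sf : superlinear_on C f) (fp : forall z, C z -> f z <= p z).

Lemma cone_inf_lbound x : lbound [set p (x + z) - f z | z in C] (- p (- x)).
Proof.
move=> _ [z Cz <-]; have := fp Cz; have := sp.1 (x + z) (- x).
by rewrite addrAC subrr add0r; lra.
Qed.

Lemma cone_inf_le x z : C z -> cone_inf p C f x <= p (x + z) - f z.
Proof.
by move=> Cz; apply: ge_inf; [exists (- p (- x)); exact: cone_inf_lbound|exists z].
Qed.

Lemma le_cone_inf x M : (forall z, C z -> M <= p (x + z) - f z) ->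
  M <= cone_inf p C f x.
Proof.
have [C0 _ _] := coneC.
by move=> Mle; apply: lb_le_inf => [|_ [z Cz <-]]; [exists (p (x + 0) - f 0), 0|exact: Mle].
Qed.

Lemma superlinear_on0 : 0 <= f 0.
Proof.
by have [C0 _ _] := coneC; have := sf.2 0 0 (lexx 0) C0; rewrite mul0r scale0r.
Qed.

Lemma cone_inf_le_self x : cone_inf p C f x <= p x.
Proof.
have [C0 _ _] := coneC; apply: le_trans (cone_inf_le x C0) _.
by rewrite addr0 gerBl superlinear_on0.
Qed.

Lemma sublinear_cone_inf : sublinear (cone_inf p C f).
Proof.
have [C0 CD CZ] := coneC; split=> [x y|t x].
  rewrite -lerBlDr; apply: le_cone_inf => z Cz; rewrite lerBlDr -lerBlDl.
  apply: le_cone_inf => z' Cz'; rewrite lerBlDl.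
  apply: le_trans (cone_inf_le _ (CD _ _ Cz Cz')) _.
  have := sp.1 (x + z) (y + z'); have := sf.1 _ _ Cz Cz'.
  by rewrite addrACA; lra.
rewrite le_eqVlt => /predU1P[<-|t0].
  rewrite scale0r mul0r; apply: le_trans (cone_inf_le_self _) _.
  by rewrite sublinear0.
rewrite -ler_pdivrMl//; apply: le_cone_inf => z Cz; rewrite ler_pdivrMl//.
apply: le_trans (cone_inf_le _ (CZ t _ (ltW t0) Cz)) _.
by rewrite -scalerDr (sublinearZ _ sp (ltW t0)) mulrBr lerD2l lerN2 sf.2// ltW.
Qed.

Lemma cone_infN z : C z -> cone_inf p C f (- z) <= - f z.
Proof.
by move=> /(cone_inf_le (- z)); rewrite addNr sublinear0// sub0r.
Qed.

End cone_inf.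

(** Minimality for the pointwise order among sublinear functionals. *)
Definition minimal_sublinear q := sublinear q /\
  forall q', sublinear q' -> (forall x, q' x <= q x) -> forall x, q x <= q' x.

(** Zorn's lemma: the pointwise infimum of a chain of sublinear functionals
    below [p] is sublinear. *)
Lemma exists_minimal_sublinear p : sublinear p ->
  exists2 q, minimal_sublinear q & forall x, q x <= p x.
Proof.
move=> sp.
pose T := {q | sublinear q /\ forall x, q x <= p x}.
pose ge (q q' : T) := `[< forall x, sval q' x <= sval q x >].
have p_le (q : T) x : sval q x <= p x by case: q => q []/=.
have sT (q : T) : sublinear (sval q) by case: q => q []/=.
have p0 : T by exists p.
have [||A Atot|q qmin] := @ZL_preorder T p0 ge.
- by move=> q; apply/asboolP.
- move=> q1 q2 q3 /asboolP h1 /asboolP h2; apply/asboolP => x.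
  exact: le_trans (h2 x) (h1 x).
- have [[q0 Aq0]|A0] := pselect (exists q : T, A q); last first.
    by exists p0 => q Aq; case: A0; exists q.
  pose m x := inf [set sval q x | q in A].
  have m_le (q : T) x : A q -> m x <= sval q x.
    move=> Aq; apply: ge_inf; last by exists q.
    exists (- p (- x)) => _ [q' Aq' <-].
    have := p_le q' (- x); have := (sT q').1 x (- x).
    by rewrite subrr sublinear0//; lra.
  have le_m x M : (forall q : T, A q -> M <= sval q x) -> M <= m x.
    move=> Mle; apply: lb_le_inf; first by exists (sval q0 x), q0.
    by move=> _ [q Aq <-]; exact: Mle.
  have sm : sublinear m.
    split=> [x y|t x t0].
      rewrite -lerBlDr; apply: (le_m _ _) => q Aq; rewrite lerBlDr -lerBlDl.
      apply: (le_m _ _) => q' Aq'; rewrite lerBlDl.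
      have [/asboolP qq'|/asboolP q'q] := Atot _ _ Aq Aq'.
        apply: le_trans (m_le _ _ Aq') _; apply: le_trans ((sT q').1 x y) _.
        by rewrite lerD2r.
      apply: le_trans (m_le _ _ Aq) _; apply: le_trans ((sT q).1 x y) _.
      by rewrite lerD2l.
    move: t0; rewrite le_eqVlt => /predU1P[<-|t0].
      rewrite scale0r mul0r; apply: le_trans (m_le _ _ Aq0) _.
      by rewrite sublinear0.
    rewrite -ler_pdivrMl//; apply: (le_m _ _) => q Aq; rewrite ler_pdivrMl//.
    by apply: le_trans (m_le _ _ Aq) _; rewrite sublinearZ// ltW.
  have mp x : m x <= p x by apply: le_trans (m_le _ _ Aq0) _.
  by exists (exist _ m (conj sm mp)) => q Aq; apply/asboolP => x /=; exact: m_le.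
exists (sval q) => //; split=> // q' sq' q'q x.
have q'p y : q' y <= p y by apply: le_trans (q'q y) _.
have /asboolP := qmin (exist _ q' (conj sq' q'p)) (asboolT q'q).
exact.
Qed.

(** The closed half-line from [0] through [x]. *)
Definition ray (x : V) : set V := [set t *: x | t in [set t : R | 0 <= t]].

Lemma convex_cone_ray x : convex_cone (ray x).
Proof.
split=> [|_ _ [s /= s0 <-] [t /= t0 <-]|t _ t0 [s /= s0 <-]].
- by exists 0; rewrite /= ?scale0r.
- by exists (s + t); rewrite /= ?addr_ge0// scalerDl.
- by exists (t * s); rewrite /= ?mulr_ge0// scalerA.
Qed.

Lemma ray_self x : ray x x.
Proof. by exists 1; rewrite /= ?scale1r. Qed.

Lemma superlinear_on_ray p x : sublinear p -> superlinear_on (ray x) p.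
Proof.
move=> sp; split=> [_ _ [s /= s0 <-] [t /= t0 <-]|t y t0 _]; last first.
  by rewrite sublinearZ.
by rewrite -scalerDl !sublinearZ ?addr_ge0// mulrDl.
Qed.

(** The functional [cone_inf q (ray x) q] is sublinear, lies below [q] and is at
    most [- q x] at [- x]; minimality of [q] gives [q (- x) <= - q x]. *)
Lemma minimal_sublinear_linear q : minimal_sublinear q -> scalar q.
Proof.
move=> [sq qmin].
have qN x : q (- x) = - q x.
  apply/le_anti/andP; split; last first.
    by have := sq.1 x (- x); rewrite subrr sublinear0//; lra.
  have sup_ray := superlinear_on_ray x sq.
  have cone_ray := convex_cone_ray x.
  have qq z : ray x z -> q z <= q z by [].
  apply: le_trans (cone_infN sq qq (ray_self x)).
  apply: qmin; first exact: sublinear_cone_inf.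
  by move=> y; apply: cone_inf_le_self.
have qD x y : q (x + y) = q x + q y.
  apply/le_anti/andP; split; first exact: sq.1.
  by have := sq.1 (x + y) (- y); rewrite addrK qN; lra.
move=> t x y; rewrite qD; congr (_ + _).
have [t0|/ltW t0] := leP 0 t; first by rewrite (sublinearZ _ sq).
by rewrite -[t]opprK scaleNr qN (sublinearZ _ sq) ?oppr_ge0// !mulNr.
Qed.

(** A superlinear functional on a convex cone and a sublinear functional above it
    can be separated by a linear functional. *)
Theorem hahn_banach_sandwich p C f : sublinear p -> convex_cone C ->
    superlinear_on C f -> (forall z, C z -> f z <= p z) ->
  exists g : V -> R, [/\ scalar g, forall x, g x <= p x &
    forall z, C z -> f z <= g z].
Proof.
move=> sp coneC sf fp.
have [g gmin gle] := exists_minimal_sublinear (sublinear_cone_inf sp coneC sf fp).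
have lg := minimal_sublinear_linear gmin.
exists g; split=> // [x|z Cz].
  by apply: le_trans (gle x) _; apply: cone_inf_le_self.
have := le_trans (gle (- z)) (cone_infN sp fp Cz).
have -> : - z = -1 *: z + 0 by rewrite addr0 scaleN1r.
by rewrite lg (sublinear0 gmin.1); lra.
Qed.

End hahn_banach.

(** * Duals of normed spaces *)

Section dual_lemmas.
Context {R : realType} {V : normedModType R}.
Implicit Types phi : dual V.

Lemma le_dual phi v : `|phi v| <= `|phi| * `|v|.
Proof. exact: le_dual_norm. Qed.

Lemma dual0 phi : phi 0 = 0.
Proof. by have := dualZ phi 0 0; rewrite scale0r mul0r. Qed.

Lemma dualN phi v : phi (- v) = - phi v.
Proof. by rewrite -[- v]sub0r dualB dual0 sub0r. Qed.

Lemma dual_norming phi (r : R) : 0 <= r -> r < `|phi| ->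
  exists2 v, `|v| <= 1 & r < phi v.
Proof.
move=> r0 rphi; apply: contrapT => nv.
have : `|phi| <= r; last by rewrite leNgt rphi.
apply: sup_family_le => // v /= v1; rewrite ler_norml.
apply/andP; split; rewrite leNgt; apply/negP => rv; apply: nv; last by exists v.
by exists (- v); rewrite ?normrN// dualN; lra.
Qed.

Lemma closed_normP (S : set V) : closed S <->
  forall x, (forall r : R, 0 < r -> exists2 s, S s & `|x - s| < r) -> S x.
Proof.
split=> [Scl x xS|Scl x xS].
  apply: Scl => B /nbhs_ballP[r /= r0 rB]; have [s Ss xs] := xS r r0.
  by exists s; split=> //; apply: rB; rewrite -ball_normE.
apply: Scl => r r0; have [s [Ss]] := xS _ (nbhsx_ballx x r r0).
by rewrite -ball_normE; exists s.
Qed.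

Lemma closed_subspace_ker phi : closed_subspace [set v | phi v = 0].
Proof.
split=> [|/=|a u v /= u0 v0]; first 1 last.
- by rewrite dual0.
- by rewrite (dual_linear phi) u0 v0 mulr0 addr0.
apply: (@closed_comp _ _ phi [set 0]) => [v _|]; first exact: dual_continuous.
exact: closed_eq.
Qed.

Lemma sublinear_norm : sublinear (fun x : V => `|x|).
Proof. by split=> [x y|t x t0]; rewrite ?ler_normD// normrZ ger0_norm. Qed.

Lemma sublinear_support (p : V -> R) (w : V) :
    sublinear p -> (forall x, p x <= `|x|) ->
  exists phi : dual V, [/\ `|phi| <= 1, forall x, phi x <= p x & phi w = p w].
Proof.
move=> sp p_le.
have [g [lg gp gw]] := hahn_banach_sandwich sp (convex_cone_ray w)
  (superlinear_on_ray w sp) (fun _ _ => lexx _).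
have gN x : - g x <= p (- x).
  have g0 : g 0 = 0 by have := lg (-1) 0 0; rewrite scaler0 addr0; lra.
  by have := lg (-1) x 0; have := gp (- x); rewrite scaleN1r addr0 g0; lra.
have g_bound x : `|g x| <= 1 * `|x|.
  rewrite mul1r ler_norml (le_trans (gp _) (p_le _)) andbT.
  by rewrite lerNl (le_trans (gN _))// (le_trans (p_le _))// normrN.
exists (MkDual (bounded_dualP lg g_bound)); split=> //.
  exact: dual_norm_le.
by apply/le_anti; rewrite gp/=; exact/gw/ray_self.
Qed.

Lemma norm_le_dual (v : V) (M : R) :
  (forall phi, `|phi| <= 1 -> phi v <= M) -> `|v| <= M.
Proof.
by move=> vM; have [phi [phi1 _ <-]] := sublinear_support v sublinear_norm
  (fun _ => lexx _); exact: vM.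
Qed.

(** For a point [w] outside the closed subspace [S], the distance to [S] is a
    sublinear functional that is positive at [w]; a linear functional below it
    with the same value at [w] vanishes on [S] but not at [w]. *)
Lemma annihilator_eq0_full (S : set V) : closed_subspace S ->
    (forall phi, (forall s, S s -> phi s = 0) -> phi = 0) ->
  forall x, S x.
Proof.
move=> [Scl S0 Slin] Sann w; apply: contrapT => Sw.
have SZ t z : S z -> S (t *: z) by move=> Sz; rewrite -[_ *: _]addr0; exact: Slin.
have coneS : convex_cone S.
  split=> // [x y Sx Sy|t x _]; last exact: SZ.
  by rewrite -[x]scale1r; exact: Slin.
have sup0 : superlinear_on S (fun=> 0 : R).
  by split=> *; rewrite ?addr0 ?mulr0.
have n0 z : S z -> 0 <= `|z| :> R by [].
(* [d] is the distance to [S], since [S = - S]. *)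
pose d := cone_inf (fun x : V => `|x|) S (fun=> 0).
have sd : sublinear d := sublinear_cone_inf sublinear_norm coneS sup0 n0.
have d_le x : d x <= `|x| := cone_inf_le_self sublinear_norm coneS sup0 n0 x.
have dS z : S z -> d z <= 0.
  move=> Sz; have := cone_infN sublinear_norm n0 (SZ (-1) _ Sz).
  by rewrite scaleN1r opprK oppr0.
have d_w : 0 < d w.
  rewrite ltNge; apply/negP => dw; apply: Sw; move/closed_normP: Scl; apply => r r0.
  apply: contrapT => far; have : r <= d w; last by lra.
  apply: (le_cone_inf coneS) => z Sz; rewrite subr0 leNgt; apply/negP => ltr.
  by apply: far; exists (- z); rewrite ?opprK// -scaleN1r; exact: SZ.
have [phi [_ phid phiw]] := sublinear_support w sd d_le.
have phi0 : phi = 0.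
  apply: Sann => s Ss; have := le_trans (phid _) (dS _ (SZ (-1) _ Ss)).
  by have := le_trans (phid _) (dS _ Ss); rewrite scaleN1r dualN; lra.
by move: d_w; rewrite -phiw phi0 ltxx.
Qed.

End dual_lemmas.

Lemma isometric_isomorphism_comp (R : realType) (E F G : normedModType R)
    (phi : E -> F) (psi : F -> G) :
  isometric_isomorphism phi -> isometric_isomorphism psi ->
  isometric_isomorphism (fun x => psi (phi x)).
Proof.
move=> [lphi nphi sphi] [lpsi npsi spsi]; split=> [a x y|x|z].
- by rewrite lphi lpsi.
- by rewrite npsi nphi.
- by have [y <-] := spsi z; have [x <-] := sphi y; exists x.
Qed.

Lemma isometric_isomorphism0 (R : realType) (E F : normedModType R)
    (phi : E -> F) : isometric_isomorphism phi -> phi 0 = 0.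
Proof. by move=> [_ nphi _]; apply/normr0_eq0; rewrite nphi normr0. Qed.

(** * The dual of the Arens-Eells space *)

Section arens_eells.
Context {R : realType} {Y : metricType R} {e : Y}.

Lemma delta_in_AE p : delta e p \in @AE_pred R Y e.
Proof. by rewrite !inE => S [_]; apply; exists p. Qed.

(** The evaluation at [p], as a point of the Arens-Eells space. *)
Definition AE_delta p : AE e := MkAE (delta_in_AE p).

Lemma le_norm_deltaB p q : `|delta e p - delta e q| <= mdist p q.
Proof.
apply: dual_norm_le => [|f]; first exact: mdist_ge0.
by rewrite mulrC; exact: (le_lipnum p q (lip0_lipschitz f)).
Qed.

(** The evaluations generate the Arens-Eells space also as a closed subspace of
    itself, not only inside the dual of [Lip0]. *)
Lemma AE_ind (S : set (AE e)) : closed_subspace S ->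
  (forall p, S (AE_delta p)) -> forall m, S m.
Proof.
move=> [/closed_normP Scl S0 Slin] Sdelta.
have imS : closed_subspace [set AE_val m | m in S].
  split=> [||a _ _ [m Sm <-] [n Sn <-]]; last by exists (a *: m + n) => //; exact: Slin.
    apply/closed_normP => n nS.
    have nP : n \in @AE_pred R Y e.
      rewrite !inE => D DP; have [[/closed_normP Dcl _ _] _] := DP.
      apply: Dcl => r r0.
      have [_ [m _ <-] nm] := nS r r0; exists (AE_val m) => //.
      by have := AE_valP m; rewrite !inE; apply.
    exists (MkAE nP) => //; apply: Scl => r r0.
    by have [_ [m Sm <-] nm] := nS r r0; exists m.
  by exists 0.
move=> m; have := AE_valP m; rewrite !inE => /(_ _ (conj imS _))[].
  by move=> _ [p _ <-]; exists (AE_delta p).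
by move=> m' Sm' /val_inj <-.
Qed.

Lemma dual_AE_ext (L L' : dual (AE e)) :
  (forall p, L (AE_delta p) = L' (AE_delta p)) -> L = L'.
Proof.
move=> LL'; apply/val_inj/funext => m; apply/eqP; rewrite -subr_eq0; apply/eqP.
apply: (AE_ind (closed_subspace_ker (L - L'))) => p /=.
by rewrite -[LHS]/(L (AE_delta p) - L' (AE_delta p)) LL' subrr.
Qed.

Lemma AE_delta_base : AE_delta e = 0.
Proof. by apply/val_inj/val_inj/funext => f; exact: lip0_base. Qed.

(** A functional [L] on the Arens-Eells space is the pairing with the function
    [p |-> L (AE_delta p)]. *)
Lemma isometric_isomorphism_AE_pairing :
  isometric_isomorphism (@AE_pairing R Y e).
Proof.
split=> [a f g|f|L].
- by apply/val_inj/funext => m; exact: dual_linear.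
- apply/le_anti/andP; split.
    by apply: dual_norm_le => // m; rewrite mulrC; exact: (le_dual (AE_val m) f).
  apply: lipnum_le => // p q.
  have := le_dual (AE_pairing f) (AE_delta p - AE_delta q).
  move=> /le_trans; apply.
  by rewrite ler_wpM2l//; exact: le_norm_deltaB.
have fP : (fun p => L (AE_delta p)) \in @lip0_pred R Y e.
  rewrite inE; split; last by rewrite AE_delta_base dual0.
  apply/is_lipschitzP; exists `|L| => // p q.
  rewrite -dualB (le_trans (le_dual _ _))// ler_wpM2l//.
  exact: le_norm_deltaB.
by exists (MkLip0 fP); exact: dual_AE_ext.
Qed.

End arens_eells.

(** * Extension by zero at the adjoined base point *)

Section adjoined_base_point.
Context {R : realType} {X : metricType R}.
Implicit Types (f : Lip X) (F : Lip0 (base X)).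

Lemma lip_norm_le f (M : R) : 0 <= M ->
  (forall p q, `|f p - f q| <= M * mdist p q) -> (forall p, `|f p| <= M) ->
  `|f| <= M.
Proof.
move=> M0 fL fs; rewrite [leLHS]/Num.norm/= ge_max; apply/andP; split.
  exact: lipnum_le.
exact: sup_family_le.
Qed.

Lemma le_lip_norm_dist f p q : `|f p - f q| <= `|f| * mdist p q.
Proof.
rewrite (le_trans (le_lipnum p q (lip_lipschitz f)))// ler_wpM2r ?mdist_ge0//.
by rewrite [leRHS]/Num.norm/= le_max lexx.
Qed.

Lemma le_lip_norm f p : `|f p| <= `|f|.
Proof. by rewrite [leRHS]/Num.norm/= le_max (le_supnorm _ (lip_bounded f)) orbT. Qed.

(** The norm controls the slopes for the truncated metric [min (rho, 2)], since
    [f] ranges over an interval of length at most [2 `|f|]. *)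
Lemma le_lip_norm_adjoin f p q :
  `|f p - f q| <= `|f| * mdist (Some p : adjoin X) (Some q).
Proof.
rewrite /mdist/= minr_pMr// le_min le_lip_norm_dist/=.
rewrite (le_trans (ler_normB _ _))// mulr_natr mulr2n.
by rewrite lerD// le_lip_norm.
Qed.

Fact restr_subproof F : (fun x => F (Some x)) \in @lip_pred R X.
Proof.
have FL p q := le_lipnum p q (lip0_lipschitz F).
rewrite inE; split.
  apply/is_lipschitzP; exists (lipnum F); first exact: lipnum_ge0.
  move=> p q; rewrite (le_trans (FL _ _))// ler_wpM2l ?lipnum_ge0//.
  by rewrite ge_min lexx.
exists (lipnum F) => _ [x _ <-].
by have := FL (Some x) (base X); rewrite lip0_base subr0 /mdist/= mulr1.
Qed.

(** The restriction to [X] of a function on [X] with a base point adjoined; the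
    inverse of [ext0]. *)
Definition restr F : Lip X := MkLip (restr_subproof F).

Lemma restrK : cancel restr (@ext0 R X).
Proof.
by move=> F; apply/val_inj/funext => -[x|] //=; rewrite (lip0_base F).
Qed.

Lemma linear_restr : linear restr.
Proof. by move=> a F G; apply/val_inj. Qed.

Lemma le_norm_restr F : `|restr F| <= `|F|.
Proof.
have FL p q : `|F p - F q| <= `|F| * mdist p q := le_lipnum p q (lip0_lipschitz F).
apply: lip_norm_le => // [p q|p] /=.
  by rewrite (le_trans (FL _ _))// ler_wpM2l// ge_min lexx.
by have := FL (Some p) (base X); rewrite lip0_base subr0 /mdist/= mulr1.
Qed.

Lemma isometric_isomorphism_ext0 : isometric_isomorphism (@ext0 R X).
Proof.
split=> [a f g|f|F]; last by exists (restr F); exact: restrK.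
  by apply/val_inj/funext => -[x|] //=; rewrite -[RHS]/(a * 0 + 0) mulr0 addr0.
apply/le_anti/andP; split; last first.
  by have := le_norm_restr (ext0 f); congr (`|_| <= _); exact: val_inj.
apply: lipnum_le => // -[p|] [q|] /=; rewrite ?subr0 ?sub0r ?normrN.
- exact: le_lip_norm_adjoin.
- by rewrite mulr1 le_lip_norm.
- by rewrite mulr1 le_lip_norm.
- by rewrite normr0 mulr0.
Qed.

End adjoined_base_point.

(** * A function that peaks at a point *)

Section peak.
Context {R : realType} {X : metricType R}.
Variable p : X.

(** A function with values in [[0, 1]] whose maximum [1] is attained only at [p],
    with slopes at most [1 / 2]: among the slopes of its extension by [0] to the
    base point, only those between the base point and points close to [p] are
    close to [1]. *)
Definition peak_fun (q : X) : R := 1 - Num.min (mdist p q) 2 / 2.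

Lemma peak_fun_ge0 q : 0 <= peak_fun q.
Proof. by have := ge_min 2 (mdist p q) 2; rewrite lexx orbT /peak_fun => h; lra. Qed.

Lemma peak_fun_le1 q : peak_fun q <= 1.
Proof.
have : 0 <= Num.min (mdist p q) 2 by rewrite le_min mdist_ge0/=.
by rewrite /peak_fun; lra.
Qed.

Lemma peak_fun_lip q r : `|peak_fun q - peak_fun r| <= 2^-1 * mdist q r.
Proof.
have := metric_triangle p q r; have := metric_triangle p r q.
rewrite (metric_sym r q) ler_norml /peak_fun /Num.min.
by case: ltP => ?; case: ltP => ? *; apply/andP; split; lra.
Qed.

Fact peak_subproof : peak_fun \in @lip_pred R X.
Proof.
rewrite inE; split.
  apply/is_lipschitzP; exists 2^-1; [lra|exact: peak_fun_lip].
by exists 1 => _ [q _ <-]; rewrite ger0_norm ?peak_fun_le1// peak_fun_ge0.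
Qed.

Definition peak : Lip X := MkLip peak_subproof.

Lemma peak_center : peak p = 1.
Proof. by rewrite /= /peak_fun mdistxx min_l// mul0r subr0. Qed.

Lemma norm_peak_ge1 : 1 <= `|peak|.
Proof. by have := le_lip_norm peak p; rewrite peak_center normr1. Qed.

(** With [h] the peak function, the Lipschitz number of [4 h + f] is at most
    [4 / 2 + 1 <= 4 + f p], and away from [p] the decrease
    [2 min (rho (p, q), 2)] of [4 h] dominates the variation of [f]. *)
Lemma norm_peak_add (f : Lip X) : `|f| <= 1 -> `|4 *: peak + f| <= 4 + f p.
Proof.
move=> f1; have f_le q : `|f q| <= 1 := le_trans (le_lip_norm f q) f1.
have f_dist q r : `|f q - f r| <= mdist q r.
  by rewrite (le_trans (le_lip_norm_dist _ _ _))// ler_piMl// mdist_ge0.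
have fp := f_le p; rewrite ler_norml in fp; have {fp}/andP[fp1 fp2] := fp.
apply: lip_norm_le => [|q r|q]; first lra.
- have -> : (4 *: peak + f) q - (4 *: peak + f) r =
    4 * (peak_fun q - peak_fun r) + (f q - f r).
    by rewrite -[_ q]/(4 * peak_fun q + f q) -[_ r]/(4 * peak_fun r + f r); lra.
  have := peak_fun_lip q r; have := f_dist q r; have := mdist_ge0 q r.
  move=> d0; rewrite !ler_norml => /andP[h1 h2] /andP[h3 h4].
  have : 3 * mdist q r <= (4 + f p) * mdist q r by rewrite ler_wpM2r//; lra.
  by move=> h5; apply/andP; split; lra.
- rewrite -[_ q]/(4 * peak_fun q + f q).
  have := f_dist q p; have := f_le q; have := peak_fun_ge0 q.
  rewrite (metric_sym q p) !ler_norml /peak_fun /Num.min.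
  by case: ltP => ? ? /andP[h1 h2] /andP[h3 h4]; apply/andP; split; lra.
Qed.

End peak.

(** * Evaluations belong to every predual *)

Section isometric_dual.
Context {R : realType} {E : normedModType R} {W : completeNormedModType R}.
Variable phi : E -> dual W.
Hypothesis iso_phi : isometric_isomorphism phi.

Lemma iso_le f w : `|phi f w| <= `|f| * `|w|.
Proof. by have [_ nphi _] := iso_phi; rewrite -(nphi f); exact: le_dual. Qed.

Lemma iso_comb a f g w : phi (a *: f + g) w = a * phi f w + phi g w.
Proof. by have [-> _ _] := iso_phi. Qed.

Lemma isoN f w : phi (- f) w = - phi f w.
Proof.
have := iso_comb (-1) f 0 w.
by rewrite addr0 scaleN1r (isometric_isomorphism0 iso_phi) addr0 mulN1r.
Qed.

Lemma isoZ a f w : phi (a *: f) w = a * phi f w.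
Proof.
have := iso_comb a f 0 w.
by rewrite addr0 (isometric_isomorphism0 iso_phi) addr0.
Qed.

(** The predual is norm closed among the functionals on its dual: the sets of [w]
    that represent [m] up to [eta] form a Cauchy filter base. *)
Lemma predual_closed (m : E -> R) :
  (forall eta : R, 0 < eta ->
    exists w, forall f, `|phi f w - m f| <= eta * `|f|) ->
  exists w, forall f, phi f w = m f.
Proof.
move=> approx.
pose A (eta : R) := [set w | forall f, `|phi f w - m f| <= eta * `|f|].
pose F := filter_from [set eta : R | 0 < eta] A.
have FF : ProperFilter F.
  apply: filter_from_proper => [|eta /approx[w Aw]]; last by exists w.
  apply: filter_from_filter; first by exists 1 => /=.
  move=> a b /= a0 b0; exists (Num.min a b); first by rewrite /= lt_min a0.
  move=> w Aw; split=> f; apply: le_trans (Aw f) _.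
    by rewrite ler_wpM2r// ge_min lexx.
  by rewrite ler_wpM2r// ge_min lexx orbT.
have /cauchy_cvgP/cvg_ex[l Fl] : cauchy F.
  apply/cauchy_ballP => r r0.
  have r4 : 0 < r / 4 by lra.
  exists (A (r / 4), A (r / 4)); first by split; exists (r / 4).
  move=> [w w']/= [Aw Aw']; rewrite -ball_normE/=.
  suff : `|w - w'| <= r / 2 by lra.
  apply: norm_le_dual => psi psi1; have [_ nphi /(_ psi)[f fpsi]] := iso_phi.
  rewrite -fpsi in psi1 *; rewrite nphi in psi1; rewrite dualB.
  have := Aw f; have := Aw' f; have : r / 4 * `|f| <= r / 4 by rewrite ler_piMr// ltW.
  by rewrite !ler_norml => h /andP[h1 h2] /andP[h3 h4]; lra.
exists l => f; apply/eqP; rewrite -subr_eq0 -normr_le0; apply/ler_addgt0Pl => eta eta0.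
have eta1 : 0 < eta / (`|f| + 1) by rewrite divr_gt0// ltr_wpDl.
rewrite addr0; apply: le_trans (_ : eta / (`|f| + 1) * `|f| <= _); last first.
  by rewrite mulrAC ler_pdivrMr ?ltr_wpDl// mulrDr mulr1 lerDl ltW.
have cphi : (fun w => `|phi f w - m f|) @ F --> `|phi f l - m f|.
  apply: cvg_norm; apply: cvgB; last exact: cvg_cst.
  by apply: (continuous_cvg _ _ Fl); exact: dual_continuous.
apply: (@closed_cvg _ _ F _ _ (fun x => x <= eta / (`|f| + 1) * `|f|) _ _ _ cphi).
  exact: closed_le.
by exists (eta / (`|f| + 1)) => // w; exact.
Qed.

End isometric_dual.

Section Lip_predual.
Context {R : realType} {X : metricType R} {W : completeNormedModType R}.
Variable phi : Lip X -> dual W.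
Hypothesis iso_phi : isometric_isomorphism phi.

Lemma evaluation_approx (p : X) (eta : R) : 0 < eta ->
  exists w, forall f, `|phi f w - f p| <= eta * `|f|.
Proof.
move=> eta0; have [_ nphi _] := iso_phi.
(* The bound [eta <= 1] makes [1 - eta / 4] nonnegative, as norming requires. *)
wlog eta1 : eta eta0 / eta <= 1.
  have [le1 /(_ _ eta0 le1)//|lt1 H] := leP eta 1.
  have [w wP] := H 1 ltr01 (lexx _); exists w => f.
  by rewrite (le_trans (wP f))// ler_wpM2r// ltW.
have [||w w1 peakw] := @dual_norming _ _ (phi (peak p)) (1 - eta / 4).
- lra.
- by rewrite nphi; have := norm_peak_ge1 p; lra.
have upper f : `|f| <= 1 -> phi f w <= f p + eta.
  move=> f1; have := iso_le iso_phi (4 *: peak p + f) w.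
  rewrite (iso_comb iso_phi) => /(le_trans (ler_norm _)).
  have := norm_peak_add p f1.
  have : `|4 *: peak p + f| * `|w| <= `|4 *: peak p + f| by rewrite ler_piMr.
  by lra.
have both f : `|f| <= 1 -> `|phi f w - f p| <= eta.
  move=> f1; have := upper _ f1; have := upper (- f); rewrite normrN => /(_ f1).
  rewrite (isoN iso_phi) -[(- f) p]/(- f p) ler_norml => h1 h2.
  by apply/andP; split; lra.
exists w => f; have [->|f0] := eqVneq f 0.
  by rewrite (isometric_isomorphism0 iso_phi) subrr !normr0 mulr0.
have fgt0 : 0 < `|f| by rewrite normr_gt0.
have := both (`|f|^-1 *: f); rewrite normrZ normfV normr_id mulVf ?gt_eqF// lexx.
move=> /(_ isT); rewrite (isoZ iso_phi) -[(_ *: f) p]/(`|f|^-1 * f p) -mulrBr.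
by rewrite normrM normfV normr_id mulrC ler_pdivrMr.
Qed.

Lemma evaluation_in_predual (p : X) : exists w, forall f, phi f w = f p.
Proof.
by apply: (predual_closed iso_phi) => eta; exact: evaluation_approx.
Qed.

(** The vectors of [W] that are sent into a given closed subspace containing the
    evaluations form a closed subspace with trivial annihilator. *)
Lemma predual_in_AE (w : W) :
  exists m : AE (base X), forall f, phi f w = AE_pairing (ext0 f) m.
Proof.
have TP v : (fun F : Lip0 (base X) => phi (restr F) v) \in @dual_pred R _.
  apply: (@bounded_dualP _ _ _ `|v|) => [a F G|F].
    by rewrite linear_restr (iso_comb iso_phi).
  rewrite mulrC (le_trans (iso_le iso_phi _ _))// ler_wpM2r//.
  exact: le_norm_restr.
(* [T v] is the action of [v] on [Lip0 (base X)], identified with [Lip X]. *)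
pose T v := MkDual (TP v).
have T_lip u v : `|T u - T v| <= `|u - v|.
  apply: dual_norm_le => // F.
  rewrite -[(T u - T v) F]/(phi (restr F) u - phi (restr F) v) -dualB mulrC.
  rewrite (le_trans (iso_le iso_phi _ _))// ler_wpM2r//.
  exact: le_norm_restr.
have TwP : T w \in @AE_pred R _ (base X).
  rewrite !inE => D [[/closed_normP Dcl D0 Dlin] Ddelta].
  apply: (annihilator_eq0_full (S := [set v | D (T v)])).
    split=> [|/=|a u v /= Du Dv].
    - apply/closed_normP => v vD; apply: Dcl => r r0.
      have [s Ds vs] := vD _ r0; exists (T s) => //.
      exact: le_lt_trans (T_lip _ _) vs.
    - suff -> : T 0 = 0 by [].
      by apply/val_inj/funext => F /=; rewrite dual0.
    - suff -> : T (a *: u + v) = a *: T u + T v by exact: Dlin.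
      by apply/val_inj/funext => F /=; exact: dual_linear.
  move=> psi psi0; have [_ _ /(_ psi)[f fpsi]] := iso_phi.
  rewrite -fpsi in psi0 *; suff -> : f = 0 by exact: isometric_isomorphism0.
  apply/val_inj/funext => p; have [v vp] := evaluation_in_predual p.
  rewrite -[LHS]vp; apply: psi0 => /=.
  suff -> : T v = delta (base X) (Some p) by apply: Ddelta; exists (Some p).
  by apply/val_inj/funext => F /=; rewrite vp.
exists (MkAE TwP) => f /=; congr (phi _ w); exact: val_inj.
Qed.

End Lip_predual.

(** * Weak* continuity *)

Section weakstar.
Context {R : realType} {V : normedModType R}.

Lemma continuous_weakstar_eval (v : V) :
  continuous ((fun phi : dual V => phi v) : weakstar V -> R).
Proof.
move=> phi.
exact: (continuous_comp (@initial_continuous _ _ _ phi)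
  (@proj_continuous _ (fun=> R) v _)).
Qed.

Lemma continuous_to_weakstar (T : topologicalType) (g : T -> weakstar V) :
  (forall v, continuous (fun t => (g t : dual V) v)) -> continuous g.
Proof.
move=> cg; apply: continuous_comp_initial => t.
by apply/pointwise_cvgP => v; have := cg v t.
Qed.

End weakstar.

Theorem theorem2p4 (R : realType) (X : metricType R) :
  strongly_unique_predual
    (fun f : Lip X => AE_pairing (ext0 f) : dual (AE (base X))).
Proof.
split.
  exact: isometric_isomorphism_comp isometric_isomorphism_ext0
    isometric_isomorphism_AE_pairing.
move=> W phi iso_phi; apply: continuous_to_weakstar => w.
have [m mP] := predual_in_AE iso_phi w.
rewrite (funext mP) => f.
exact: (continuous_comp (@initial_continuous _ _ _ f)
  (@continuous_weakstar_eval _ _ m _)).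
Qed.
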